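(* Let $k\geqslant 3$ and $1\leqslant t\leqslant k-2$ be integers, let $n\geqslant k^4$, and let $\mathcal{F}\subseteq\binom{[n]}{k}$ be a $t$-intersecting family. Then $N_{3,t}(\mathcal{F})\leqslant N_{3,t}(\mathcal{G}_{2,t})$, and equality holds if and only if, up to isomorphism, $\mathcal{G}_{2,t}\subseteq\mathcal{F}\subseteq\mathcal{G}'_{2,t}$.
   Context: $[n]=\{1,\dots,n\}$ and $\binom{[n]}{k}$ is the family of all $k$-element subsets of $[n]$. A family $\mathcal{F}$ is $t$-intersecting if $|F\cap F'|\geqslant t$ for all $F,F'\in\mathcal{F}$; more generally it is $r$-wise $t$-intersecting if $|F_1\cap\cdots\cap F_r|\geqslant t$ for all $F_1,\dots,F_r\in\mathcal{F}$. A $(r+1,t)$-triangle is a family $\{T_1,\dots,T_{r+1}\}$ of $r+1$ sets which is $r$-wise $t$-intersecting and satisfies $|T_1\cap\cdots\cap T_{r+1}|\leqslant t-1$. For a family $\mathcal{F}$, $N_{r+1,t}(\mathcal{F})$ denotes the number of $(r+1)$-element subfamilies of $\mathcal{F}$ that are $(r+1,t)$-triangles. Define $\mathcal{G}_{r,t}=\{F\in\binom{[n]}{k}: |F\cap[r+t]|=r+t-1\}$ and $\mathcal{G}'_{r,t}=\{F\in\binom{[n]}{k}: |F\cap[r+t]|\geqslant r+t-1\}$. Two families are isomorphic if one is obtained from the other by a permutation of $[n]$. *)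

(* Defs.v *)
From mathcomp Require Import all_boot all_fingroup.

Set Implicit Arguments.
Unset Strict Implicit.
Unset Printing Implicit Defensive.

(* The ground set [n] = {1, ..., n} is 'I_n, so that element i of [n] is the
   ordinal of value i - 1. *)

Definition init_seg (n m : nat) : {set 'I_n} := [set i : 'I_n | i < m].

Definition ksubsets (n k : nat) : {set {set 'I_n}} :=
  [set A : {set 'I_n} | #|A| == k].

Definition t_intersecting (T : finType) (t : nat) (F : {set {set T}}) : bool :=
  [forall A in F, forall B in F, t <= #|A :&: B|].

(* The r members need not be distinct. *)
Definition rwise_t_intersecting (T : finType) (r t : nat)
    (F : {set {set T}}) : bool :=
  [forall f : {ffun 'I_r -> {set T}},
     [forall i, f i \in F] ==> (t <= #|\bigcap_(i < r) f i|)].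

(* The (r+1,t)-triangles. The condition "at most t - 1" is written "< t" to
   avoid truncated subtraction. *)
Definition triangle (T : finType) (r t : nat) (S : {set {set T}}) : bool :=
  [&& #|S| == r.+1, rwise_t_intersecting r t S & #|\bigcap_(A in S) A| < t].

(* N_{r+1,t}(F); note the argument is r, not r + 1. *)
Definition num_triangles (T : finType) (r t : nat) (F : {set {set T}}) : nat :=
  #|[set S : {set {set T}} | (S \subset F) && triangle r t S]|.

Definition G_fam (n k r t : nat) : {set {set 'I_n}} :=
  [set A in ksubsets n k | #|A :&: init_seg n (r + t)| == r + t - 1].

Definition G'_fam (n k r t : nat) : {set {set 'I_n}} :=
  [set A in ksubsets n k | r + t - 1 <= #|A :&: init_seg n (r + t)|].

Definition isomorphic (T : finType) (F F' : {set {set T}}) : Prop :=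
  exists s : {perm T}, F' = [set s @: A | A : {set T} in F].

(* Main.v *)
(** Let m and w be the numbers of k-sets through a fixed (t+1)-set and a fixed
    (t+2)-set; since n >= k^4, k^2 (k + 2) w <= m. The members of G_{2,t} miss
    exactly one point of a (t+2)-set Y; three of them missing distinct points
    and with no common point outside Y form a triangle, which gives at least t
    (t+1) (t+2) m^3 / 2 ordered triangles.

    A set W with |W ∩ A| >= t for all A in F is a cover. If U is not a cover,
    some C in F meets U in fewer than t points, so every member of F
    containing U uses a point of C \ U, and their number is at most k times
    the maximal number of members containing U + x. If every cover has more
    than t + 1 points, starting from the t-subsets of a minimum cover and
    extending repeatedly gives 2 |F| <= (t+1) m, which is too few; a cover of
    at most t points lies in every member of F, which leaves no triangle.

    Otherwise call a (t+1)-set heavy if more than k w members of F contain it.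
    Heavy sets are covers and pairwise t-intersecting. If three of them have
    fewer than t common points, the points lying in at least two of the three
    form a (t+2)-set Y, and every member of F misses at most one point of Y: F
    is as in the equality case. If any three heavy sets share t points, every
    triangle has a member containing no heavy set, and at most m / 3 members
    are like that. This settles the case of at most one heavy set; two or more
    heavy sets share a t-set E, and every triangle even has a member not
    containing E, of which there are at most t k w, or t w if there are three
    heavy sets. *)

Require Import Defs.
From mathcomp Require Import all_boot all_fingroup all_solvable.
From mathcomp Require Import zify.

Set Implicit Arguments.
Unset Strict Implicit.
Unset Printing Implicit Defensive.

(** * Finite sets *)

Section FiniteSets.

Variables I T : finType.
Implicit Types (A B U V X Y : {set T}) (f : I -> {set T}).

Lemma card_bigcup_le (P : pred I) f :
  #|\bigcup_(i | P i) f i| <= \sum_(i | P i) #|f i|.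
Proof.
elim/big_rec2: _ => [|i s X _ le_Xs]; first by rewrite cards0.
by rewrite (leq_trans (leq_card_setU _ _)) ?leq_add2l.
Qed.

Lemma card_covered_le X (J : {set I}) f b :
  {in X, forall x, exists2 i, i \in J & x \in f i} ->
  {in J, forall i, #|f i| <= b} -> #|X| <= #|J| * b.
Proof.
move=> coverX f_le; rewrite -sum_nat_const.
apply: (@leq_trans (\sum_(i in J) #|f i|)); last exact: leq_sum.
apply: leq_trans (card_bigcup_le _ _).
apply/subset_leq_card/subsetP => x /coverX[i iJ xfi].
by apply/bigcupP; exists i.
Qed.

Lemma card_disjoint_ge X (J : {set I}) f b :
  {in J, forall i, f i \subset X} ->
  (forall i j x, x \in f i -> x \in f j -> i = j) ->
  {in J, forall i, b <= #|f i|} -> #|J| * b <= #|X|.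
Proof.
move=> fX f_disj f_ge; rewrite -sum_nat_const.
apply: (@leq_trans (\sum_(i in J) #|f i|)); first exact: leq_sum.
have -> : \sum_(i in J) #|f i| = \sum_(i in J) \sum_(x in X) (x \in f i : nat).
  apply: eq_bigr => i iJ; rewrite -sum1_card big_mkcond [RHS]big_mkcond.
  apply: eq_bigr => x _; case: ifPn => [/(subsetP (fX i iJ))->|] //.
  by case: ifP.
rewrite exchange_big -sum1_card; apply: leq_sum => x _.
rewrite (_ : \sum_(_ in J) _ = #|[set i in J | x \in f i]|).
  apply/card_le1_eqP => i j /setIdP[_ xfi] /setIdP[_ xfj].
  exact: (f_disj _ _ x).
rewrite -sum1dep_card big_mkcondr; apply: eq_bigr => i _.
by case: (x \in f i).
Qed.

Lemma card_setD1 A x : x \in A -> #|A :\ x| = #|A|.-1.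
Proof. by move=> xA; rewrite (cardsD1 x A) xA. Qed.

Lemma exists_subset_card A j :
  j <= #|A| -> exists2 B : {set T}, B \subset A & #|B| = j.
Proof.
rewrite -bin_gt0 -cards_draws => /card_gt0P[B].
by rewrite inE => /andP[BA /eqP card_B]; exists B.
Qed.

Lemma card_between U V k : U \subset V -> #|U| <= k ->
  #|[set A : {set T} | [&& #|A| == k, U \subset A & A \subset V]]| =
  'C(#|V| - #|U|, k - #|U|).
Proof.
move=> UV Uk; rewrite -cardsDS // -cards_draws.
rewrite -(card_in_imset (f := fun A => A :\: U)); last first.
  move=> A B; rewrite !inE => /and3P[_ UA _] /and3P[_ UB _] eqD.
  by rewrite -(setID A U) -(setID B U) eqD (setIidPr UA) (setIidPr UB).
apply: eq_card => B; rewrite !inE; apply/imsetP/andP => [[A]|[BVU /eqP card_B]].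
  rewrite inE => /and3P[/eqP card_A UA AV] ->.
  by rewrite setSD // cardsDS // card_A.
have [BV dBU] : B \subset V /\ [disjoint B & U] by apply/andP; rewrite -subsetD.
exists (U :|: B); last first.
  by rewrite setDUl setDv set0U; apply/esym/setDidPl.
rewrite inE subsetUl subUset UV BV cardsU setIC (disjoint_setI0 dBU).
by rewrite cards0 card_B subn0 subnKC ?eqxx.
Qed.

Lemma card_setD_bigcap (P : pred I) Y f :
  #|Y :\: \bigcap_(i | P i) f i| <= \sum_(i | P i) #|Y :\: f i|.
Proof.
apply: leq_trans (card_bigcup_le P (fun i => Y :\: f i)).
apply/subset_leq_card/subsetP => x; rewrite inE => /andP[nxf xY].
have : x \in \bigcup_(i | P i) ~: f i by rewrite -setC_bigcap inE.
case/bigcupP=> i Pi; rewrite inE => nxfi.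
by apply/bigcupP; exists i => //; rewrite inE nxfi.
Qed.

End FiniteSets.

Section Majority.

Variable T : finType.
Implicit Types A B C D : {set T}.

Definition majority A B C := (A :&: B) :|: (C :&: (A :|: B)).

Lemma card_majorityE A B C :
  #|majority A B C| + 2 * #|A :&: B :&: C| =
  #|A :&: B| + #|A :&: C| + #|B :&: C|.
Proof.
have := cardsUI (A :&: B) (C :&: (A :|: B)).
have := cardsUI (C :&: A) (C :&: B).
rewrite -setIUr -/(majority A B C) setIACA setIid ![C :&: _]setIC setIA.
rewrite (_ : A :&: B :&: (A :|: B) = A :&: B); first by lia.
by apply/setIidPl; apply: subset_trans (subsetIl _ _) (subsetUl _ _).
Qed.

Lemma card_majority_le A B C : 2 * #|majority A B C| <= #|A| + #|B| + #|C|.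
Proof.
have := cardsUI A B; have := cardsUI C (A :|: B).
have := cardsUI (A :&: B) (C :&: (A :|: B)); rewrite -/(majority A B C).
have : #|majority A B C| <= #|C :|: (A :|: B)|.
  apply: subset_leq_card; rewrite subUset; apply/andP; split.
    by apply: subset_trans (subsetIl _ _) _; rewrite setUCA subsetUl.
  exact: subset_trans (subsetIl _ _) (subsetUl _ _).
lia.
Qed.

Lemma majority_setD A B C D :
  majority A B C :\: D = majority (A :\: D) (B :\: D) (C :\: D).
Proof. by rewrite /majority setDUl !setDIl setDUl. Qed.

Lemma card_setI2_le A B C : #|A :&: B| + #|A :&: C| <= #|A| + #|A :&: B :&: C|.
Proof.
have := cardsUI (A :&: B) (A :&: C); rewrite setIACA setIid setIA -setIUr => <-.
by rewrite leq_add2r subset_leq_card ?subsetIl.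
Qed.

End Majority.

Lemma exists_perm_imset (T : finType) (Y Z : {set T}) :
  #|Y| = #|Z| -> exists s : {perm T}, s @: Y = Z.
Proof.
rewrite [#|Y|]cardE => card_YZ; set m := size (enum Y) in card_YZ.
have m_trans : [transitive^m 'Sym_T, on [set: T] | 'P].
  by apply: ntransitive_weak (Sym_trans T); rewrite card_YZ max_card.
have card_Z : size (enum Z) == m by rewrite card_YZ cardE.
have uniqY : in_tuple (enum Y) \in m.-dtuple([set: T]).
  by rewrite inE enum_uniq; apply/subsetP.
have uniqZ : Tuple card_Z \in m.-dtuple([set: T]).
  by rewrite inE enum_uniq; apply/subsetP.
have [s _ /(congr1 val) /= sYZ] := atransP2 m_trans uniqY uniqZ.
exists s; apply/setP => z; rewrite -(mem_enum Z) sYZ.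
apply/imsetP/mapP => -[x xY ->]; exists x => //; first by rewrite mem_enum.
by rewrite mem_enum in xY.
Qed.

Lemma exists_injection_at (T : finType) (Y : {set T}) (l : T) n :
  l \in Y -> n < #|Y| ->
  exists a : {ffun 'I_n.+1 -> T},
    [/\ injective a, forall i, a i \in Y & a ord0 = l].
Proof.
move=> lY lt_n; pose e := l :: enum (Y :\ l).
have e_size (i : 'I_n.+1) : i < size e.
  have := leq_trans (ltn_ord i) lt_n.
  by rewrite (cardsD1 l Y) lY /= -cardE.
have e_uniq : uniq e by rewrite /= mem_enum !inE eqxx enum_uniq.
exists [ffun i : 'I_n.+1 => nth l e i]; split=> [i j|i|]; rewrite !ffunE //.
  by move/eqP; rewrite nth_uniq // => /eqP/val_inj.
have := mem_nth l (e_size i); rewrite {2}/e in_cons mem_enum.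
by case/predU1P=> [->|/setD1P[_]].
Qed.

(** * Triangles *)

Section Triangles.

Variable T : finType.
Implicit Types (A B C : {set T}) (F L S : {set {set T}}).

Lemma t_intersectingP t F :
  reflect {in F &, forall A B, t <= #|A :&: B|} (t_intersecting t F).
Proof.
apply: (iffP forall_inP) => [tF A B FA FB|tF A FA].
  exact: (forall_inP (tF A FA)).
by apply/forall_inP => B FB; apply: tF.
Qed.

Lemma rwise_t_intersectingP r t F :
  reflect (forall f : 'I_r -> {set T},
             (forall i, f i \in F) -> t <= #|\bigcap_(i < r) f i|)
          (rwise_t_intersecting r t F).
Proof.
apply: (iffP forallP) => [tF f fF|tF f].
  have := tF (finfun f); under eq_bigr do rewrite ffunE.
  by move/implyP; apply; apply/forallP => i; rewrite ffunE.
by apply/implyP => /forallP; apply: tF.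
Qed.

Lemma rwise2_t_intersecting t F :
  t_intersecting t F -> rwise_t_intersecting 2 t F.
Proof.
move=> /t_intersectingP tF; apply/rwise_t_intersectingP => f fF.
by rewrite big_ord_recl big_ord1 tF.
Qed.

Lemma rwise3_t_intersectingP t F :
  reflect {in F & &, forall A B C, t <= #|A :&: B :&: C|}
          (rwise_t_intersecting 3 t F).
Proof.
apply: (iffP (rwise_t_intersectingP 3 t F)) => [tF A B C FA FB FC|tF f fF].
  have := tF (tnth [tuple A; B; C]).
  rewrite !big_ord_recl big_ord0 setIT setIA; apply.
  by move=> i; case/tnthP: (mem_tnth i [tuple A; B; C]) => j ->;
     apply/(@all_tnthP _ _ (mem F)): j; rewrite /= FA FB FC.
by rewrite !big_ord_recl big_ord0 setIT setIA; apply: tF.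
Qed.

Lemma rwise3_t_intersectingPn t F : ~~ rwise_t_intersecting 3 t F ->
  exists A B C, [/\ A \in F, B \in F, C \in F & #|A :&: B :&: C| < t].
Proof.
rewrite negb_forall => /existsP[f].
rewrite negb_imply -ltnNge => /andP[/forallP fF].
rewrite !big_ord_recl big_ord0 setIT setIA => lt_t.
by do 3 eexists; split; [..|exact: lt_t].
Qed.

Definition triangles r t F : {set {set {set T}}} :=
  [set S : {set {set T}} | (S \subset F) && triangle r t S].

(* The [r]-wise condition of [triangle] is inherited from [F]. *)
Definition ordered_triangles r t F : {set {ffun 'I_r.+1 -> {set T}}} :=
  [set f in ffun_on (mem F) | #|\bigcap_i f i| < t].

Lemma ordered_trianglesP r t F (f : {ffun 'I_r.+1 -> {set T}}) :
  reflect ((forall i, f i \in F) /\ #|\bigcap_i f i| < t)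
          (f \in ordered_triangles r t F).
Proof. by rewrite inE; apply: (iffP andP) => -[/ffun_onP fF lt_t]. Qed.

(* A repeated member can be dropped from the intersection, which then has at
   least [t] points. *)
Lemma ordered_triangle_inj r t F f : rwise_t_intersecting r t F ->
  f \in ordered_triangles r t F -> injective f.
Proof.
move=> /rwise_t_intersectingP tF /ordered_trianglesP[fF lt_t].
apply/injectiveP; apply: contraLR lt_t => /injectivePn[i [j neq_ij eq_fij]].
have [l eq_il|eq_ij] := unliftP j i; last by rewrite eq_ij eqxx in neq_ij.
rewrite -leqNgt (bigD1_ord j) //= (setIidPr _).
  by apply: (tF (f \o lift j)) => l'; apply: fF.
by rewrite -eq_fij eq_il (bigcap_inf l).
Qed.

Lemma bigcap_imset_ffun r (f : {ffun 'I_r -> {set T}}) :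
  \bigcap_(A in f @: setT) A = \bigcap_i f i.
Proof.
apply/setP => x; apply/bigcapP/bigcapP => [xA i _|xf _ /imsetP[i _ ->]].
  by apply: xA; apply: imset_f.
exact: xf.
Qed.

Lemma imset_ordered_triangle r t F f : rwise_t_intersecting r t F ->
  f \in ordered_triangles r t F -> f @: setT \in triangles r t F.
Proof.
move=> tF tri_f; have f_inj := ordered_triangle_inj tF tri_f.
have /ordered_trianglesP[fF lt_t] := tri_f.
have im_subF : f @: setT \subset F by apply/subsetP => _ /imsetP[i _ ->].
rewrite inE im_subF /triangle card_imset // cardsT card_ord eqxx.
rewrite bigcap_imset_ffun lt_t andbT; apply/rwise_t_intersectingP => g gim.
by apply: (rwise_t_intersectingP r t F tF) => i; apply: (subsetP im_subF).
Qed.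

Lemma ordered_triangle_orderings r t F S : rwise_t_intersecting r t F ->
  S \in triangles r t F ->
  [set f in ordered_triangles r t F | f @: setT == S] =
  [set f : {ffun 'I_r.+1 -> {set T}} in ffun_on (mem S) | injectiveb f].
Proof.
move=> tF; rewrite inE => /and4P[SF /eqP card_S _ lt_t]; apply/setP => f.
apply/setIdP/setIdP => -[tri_f].
  move/eqP <-; split; first by apply/ffun_onP => i; apply: imset_f.
  exact/injectiveP/(ordered_triangle_inj tF).
move/injectiveP=> f_inj; have /ffun_onP fS := tri_f.
have im_eqS : f @: setT == S.
  rewrite eqEcard card_imset // cardsT card_ord card_S leqnn andbT.
  by apply/subsetP => _ /imsetP[i _ ->].
split=> //; apply/ordered_trianglesP; split=> [i|].
  exact: (subsetP SF).
by rewrite -bigcap_imset_ffun (eqP im_eqS).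
Qed.

Lemma card_ordered_triangles r t F : rwise_t_intersecting r t F ->
  #|ordered_triangles r t F| = r.+1`! * num_triangles r t F.
Proof.
move=> tF; rewrite -sum1_card.
rewrite (partition_big (fun f : {ffun _} => f @: setT)
                       (mem (triangles r t F))) /=.
  rewrite mulnC -sum_nat_const; apply: eq_bigr => S triS.
  have card_S : #|S| = r.+1 by move: triS; rewrite inE => /and4P[_ /eqP].
  rewrite sum1dep_card (ordered_triangle_orderings tF triS).
  by rewrite card_inj_ffuns_on card_ord card_S ffactnn.
by move=> f; apply: imset_ordered_triangle.
Qed.

Lemma card_ffun_at r (i : 'I_r.+1) F L :
  #|[set f : {ffun 'I_r.+1 -> {set T}} in ffun_on (mem F) | f i \in L]| <=
  #|L| * #|F| ^ r.
Proof.
pose allowed j := if j == i then L else F.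
have -> : #|L| * #|F| ^ r = #|family (fun j => mem (allowed j))|.
  rewrite card_family foldrE big_map big_enum (bigD1 i) //= /allowed eqxx.
  congr (_ * _); rewrite (eq_bigr (fun=> #|F|)) => [|j /negPf-> //].
  by rewrite prod_nat_const cardC1 card_ord.
apply/subset_leq_card/subsetP => f /setIdP[/ffun_onP fF fiL].
by apply/familyP => j; rewrite /allowed; case: eqP => [->|_].
Qed.

Lemma card_ordered_triangles_hit r t F L :
  {in ordered_triangles r t F, forall f : {ffun _}, exists i, f i \in L} ->
  #|ordered_triangles r t F| <= r.+1 * (#|L| * #|F| ^ r).
Proof.
rewrite -[X in _ <= X * _]card_ord -cardsT => hitL.
pose through i :=
  [set f : {ffun 'I_r.+1 -> {set T}} in ffun_on (mem F) | f i \in L].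
apply: (card_covered_le (f := through)) => [f tri_f|i _].
  have [i fiL] := hitL f tri_f; exists i; rewrite ?inE // fiL andbT.
  by move: tri_f; rewrite inE => /andP[].
exact: card_ffun_at.
Qed.

Lemma card_ordered_triangles_le r t F :
  #|ordered_triangles r t F| <= #|F| ^ r.+1.
Proof.
rewrite -[X in _ ^ X]card_ord -card_ffun_on.
by apply/subset_leq_card/subsetP => f /setIdP[].
Qed.

End Triangles.

Section Permutations.

Variable T : finType.
Implicit Types (s u : {perm T}) (F G S : {set {set T}}).

Definition relabel s F := [set s @: A | A : {set T} in F].

Lemma imset_perm_inj s : injective (fun A : {set T} => s @: A).
Proof. exact/imset_inj/perm_inj. Qed.

Lemma imset_permK s :
  cancel (fun A : {set T} => s @: A) (fun A => s^-1%g @: A).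
Proof.
move=> A; rewrite -imset_comp -[RHS]imset_id.
by apply: eq_imset => x; apply: permK.
Qed.

Lemma relabelK s : cancel (relabel s) (relabel s^-1%g).
Proof.
move=> F; rewrite /relabel -imset_comp -[RHS]imset_id.
by apply: eq_imset; apply: imset_permK.
Qed.

Lemma imset_perm_bigcap (I : finType) (P : pred I) (f : I -> {set T}) s :
  s @: (\bigcap_(i | P i) f i) = \bigcap_(i | P i) s @: f i.
Proof.
apply/setP => y; rewrite -(permKV s y) mem_imset; last exact: perm_inj.
by apply/bigcapP/bigcapP => yf i Pi; have := yf i Pi; rewrite mem_imset //;
   apply: perm_inj.
Qed.

Lemma rwise_t_intersecting_relabel r t s F :
  rwise_t_intersecting r t F ->
  rwise_t_intersecting r t (relabel s F).
Proof.
move/rwise_t_intersectingP=> tF; apply/rwise_t_intersectingP => f fF.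
have sK : cancel (fun A : {set T} => s^-1%g @: A) (fun A => s @: A).
  by move=> A; have := imset_permK s^-1%g A; rewrite invgK.
rewrite (eq_bigr (fun i => s @: (s^-1%g @: f i))) => [|i _]; last by rewrite sK.
rewrite -imset_perm_bigcap card_imset; last exact: perm_inj.
by apply: tF => i; have /imsetP[A FA ->] := fF i; rewrite imset_permK.
Qed.

Lemma triangle_relabel r t s S :
  triangle r t S -> triangle r t (relabel s S).
Proof.
case/and3P=> /eqP card_S tS lt_t; apply/and3P; split.
- by rewrite card_imset ?card_S //; apply: imset_perm_inj.
- exact: rwise_t_intersecting_relabel.
rewrite big_imset /=; last by move=> A B _ _; apply: imset_perm_inj.
by rewrite -imset_perm_bigcap card_imset //; apply: perm_inj.
Qed.

Lemma num_triangles_relabel r t s F :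
  num_triangles r t (relabel s F) = num_triangles r t F.
Proof.
have le_relabel u G : num_triangles r t G <= num_triangles r t (relabel u G).
  rewrite /num_triangles -(card_imset _ (can_inj (relabelK u))).
  apply/subset_leq_card/subsetP => _ /imsetP[S /setIdP[SG triS] ->].
  by rewrite inE imsetS ?triangle_relabel.
apply/eqP; rewrite eqn_leq le_relabel andbT.
by have := le_relabel s^-1%g (relabel s F); rewrite relabelK.
Qed.

End Permutations.

(** * Sets missing at most one point of [Y] *)

Section MissOne.

Variables (T : finType) (k r t : nat) (Y : {set T}).
Hypothesis cardY : #|Y| = r + t.
Implicit Types (A B C X : {set T}) (F S : {set {set T}}).
Implicit Types (a : {ffun 'I_r.+1 -> T}) (f : {ffun 'I_r.+1 -> {set T}}).

Definition miss_at_most_one : {set {set T}} :=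
  [set A : {set T} | (#|A| == k) && (#|Y :\: A| <= 1)].

Definition miss_one : {set {set T}} :=
  [set A : {set T} | (#|A| == k) && (#|Y :\: A| == 1)].

Lemma miss_one_sub : miss_one \subset miss_at_most_one.
Proof. by apply/subsetP => A; rewrite !inE => /andP[-> /eqP->]. Qed.

Lemma leq_card_bigcap_miss (I : finType) (P : pred I) (f : I -> {set T}) :
  \sum_(i | P i) #|Y :\: f i| <= r -> t <= #|\bigcap_(i | P i) f i|.
Proof.
move=> miss; have := leq_trans (card_setD_bigcap P Y f) miss.
have : #|Y :&: \bigcap_(i | P i) f i| <= #|\bigcap_(i | P i) f i|.
  exact/subset_leq_card/subsetIr.
by have := cardsID (\bigcap_(i | P i) f i) Y; rewrite cardY; lia.
Qed.

Lemma rwise_t_intersecting_miss F :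
  F \subset miss_at_most_one -> rwise_t_intersecting r t F.
Proof.
move=> /subsetP missF; apply/rwise_t_intersectingP => f fF.
apply: leq_card_bigcap_miss; rewrite -[leqRHS]card_ord -sum1_card.
by apply: leq_sum => i _; have := missF _ (fF i); rewrite inE => /andP[].
Qed.

Lemma triangles_miss_one F :
  F \subset miss_at_most_one -> triangles r t F \subset triangles r t miss_one.
Proof.
move=> /subsetP missF; apply/subsetP => S; rewrite !inE.
case/andP=> /subsetP SF triS; rewrite triS andbT; apply/subsetP => A SA.
have /and3P[/eqP card_S _ lt_t] := triS; rewrite inE.
have /andP[-> missA] : (#|A| == k) && (#|Y :\: A| <= 1).
  by have := missF _ (SF _ SA); rewrite inE.
rewrite eqn_leq missA; apply: contraLR lt_t.
rewrite !ltnNge !negbK leqn0 => /eqP YA.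
apply: leq_card_bigcap_miss; rewrite (big_setD1 A) //= YA add0n.
have <- : #|S :\ A| = r by rewrite card_setD1 // card_S.
rewrite -sum1_card; apply: leq_sum => B /setD1P[_ SB].
by have := missF _ (SF _ SB); rewrite inE => /andP[].
Qed.

Lemma num_triangles_miss_one_le F :
  F \subset miss_at_most_one ->
  num_triangles r t F <= num_triangles r t miss_one.
Proof. by move=> missF; rewrite subset_leq_card ?triangles_miss_one. Qed.

Lemma num_triangles_miss_one F :
  miss_one \subset F -> F \subset miss_at_most_one ->
  num_triangles r t F = num_triangles r t miss_one.
Proof.
move=> sub_oneF missF; apply/eqP; rewrite eqn_leq num_triangles_miss_one_le //=.
apply/subset_leq_card/subsetP => S; rewrite !inE => /andP[sub_S ->].
by rewrite (subset_trans sub_S).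
Qed.

(* [X] is meant to be another member of a triangle: since [C] avoids it outside
   [Y], the intersection of the triangle lies in [Y]. *)
Definition miss_only l X : {set {set T}} :=
  [set C : {set T} | [&& #|C| == k, Y :\: C == [set l] & C :&: X \subset Y]].

Hypothesis le_rt : r + t <= k.+1.

Lemma card_miss_only l X : l \in Y ->
  #|miss_only l X| = 'C(#|T| - #|Y :|: X|, k - (r + t).-1).
Proof.
move=> lY; have card_Yl : #|Y :\ l| = (r + t).-1 by rewrite card_setD1 ?cardY.
pose V := ~: (l |: (X :\: Y)).
have YlV : Y :\ l \subset V.
  by apply/subsetP => x /setD1P[xl xY]; rewrite !inE (negPf xl) xY.
have card_V : #|V| - #|Y :\ l| = #|T| - #|Y :|: X|.
  rewrite -cardsDS // [LHS]cardsCs (_ : ~: _ = Y :|: X) //; apply/setP => x.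
  rewrite !inE; case: eqVneq => [->|_] //=; first by rewrite lY.
  by rewrite andbC; case: (x \in Y); case: (x \in X).
rewrite -card_V -card_Yl -card_between ?card_Yl; [|done|lia].
apply: eq_card => C; rewrite !inE eqEsubset subDset setUC -subDset sub1set.
rewrite inE lY andbT /V setCU subsetI subsetC sub1set inE.
rewrite setCD -subDset [C :\: _]setDE setCK.
by rewrite -!andbA.
Qed.

Lemma miss_only_miss_one l X C : C \in miss_only l X -> C \in miss_one.
Proof. by rewrite !inE => /and3P[-> /eqP-> _]; rewrite cards1. Qed.

Lemma miss_only_inj l l' X X' C :
  C \in miss_only l X -> C \in miss_only l' X' -> l = l'.
Proof. by rewrite !inE => /and3P[_ /eqP-> _] /and3P[_ /eqP/set1_inj-> _]. Qed.

Lemma miss_one_miss_only A :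
  A \in miss_one -> exists2 l, l \in Y & A \in miss_only l set0.
Proof.
rewrite inE => /andP[card_A /cards1P[l YA]]; exists l.
  by have := set11 l; rewrite -YA => /setDP[].
by rewrite inE card_A YA setI0 sub0set eqxx.
Qed.

Definition triangles_through a A :
    {set {ffun 'I_r.+1 -> {set T}}} :=
  [set f in family (fun i =>
     mem (if i == ord0 then [set A] else miss_only (a i) A))].

Lemma triangles_throughP a A f :
  reflect (f ord0 = A /\ forall i, i != ord0 -> f i \in miss_only (a i) A)
          (f \in triangles_through a A).
Proof.
rewrite inE; apply: (iffP familyP) => [famf|[f0 fi] i].
  split=> [|i /negPf i0]; last by have := famf i; rewrite i0.
  by have := famf ord0; rewrite eqxx => /set1P.
by case: eqVneq => [->|/fi //]; rewrite f0 set11.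
Qed.

Let M := 'C(#|T| - k.+1, k - (r + t).-1).

Lemma card_triangles_through a A :
  (forall i, a i \in Y) -> A \in miss_one -> #|triangles_through a A| = M ^ r.
Proof.
move=> aY; rewrite inE => /andP[/eqP card_A /eqP missA].
have card_YA : #|Y :|: A| = k.+1.
  rewrite -(cardsID A) setDUl setDv setU0 missA (setIidPr (subsetUr _ _)).
  by rewrite card_A addn1.
rewrite cardsE card_family foldrE big_map big_enum (bigD1 ord0) //=.
rewrite cards1 mul1n (eq_bigr (fun=> M)) => [|i /negPf->]; last first.
  by rewrite card_miss_only ?card_YA.
by rewrite prod_nat_const cardC1 card_ord.
Qed.

Hypothesis r_gt0 : 0 < r.

Lemma triangles_through_subset a A :
  injective a -> (forall i, a i \in Y) -> A \in miss_only (a ord0) set0 ->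
  triangles_through a A \subset ordered_triangles r t miss_one.
Proof.
move=> a_inj aY missA; apply/subsetP => f /triangles_throughP[f0 fi].
have fi_only i : exists X, f i \in miss_only (a i) X.
  by have [->|/fi] := eqVneq i ord0; [exists set0; rewrite f0 | exists A].
apply/ordered_trianglesP; split=> [i|].
  by have [X /miss_only_miss_one] := fi_only i.
have cap_sub : \bigcap_i f i \subset Y :\: a @: setT.
  apply/subsetP => x /bigcapP xf; rewrite inE; apply/andP; split.
    apply/imsetP => -[i _ x_ai]; have [X] := fi_only i.
    rewrite inE => /and3P[_ /eqP/setP/(_ x)]; rewrite -x_ai.
    by rewrite !inE xf // x_ai eqxx.
  have := fi ord_max; rewrite -val_eqE -lt0n => /(_ r_gt0).
  by rewrite inE => /and3P[_ _ /subsetP]; apply; rewrite inE -f0 !xf.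
apply: leq_ltn_trans (subset_leq_card cap_sub) _; rewrite cardsDS.
  rewrite card_imset // cardsT card_ord cardY.
  have : #|a @: setT| <= #|Y|.
    by apply/subset_leq_card/subsetP => _ /imsetP[i _ ->].
  by rewrite card_imset // cardsT card_ord cardY; lia.
by apply/subsetP => _ /imsetP[i _ ->].
Qed.

Lemma card_ordered_triangles_miss_only a :
  injective a -> (forall i, a i \in Y) ->
  M ^ r.+1 <=
  #|[set f in ordered_triangles r t miss_one |
       [forall i, f i \in miss_only (a i) set0]]|.
Proof.
move=> a_inj aY; have leM : M <= #|miss_only (a ord0) set0|.
  by rewrite card_miss_only // setU0 cardY leq_bin2l // leq_sub2l.
rewrite expnS; apply: leq_trans (leq_mul leM (leqnn _)) _.
apply: (card_disjoint_ge (f := triangles_through a)) => [A missA|A B f|A missA].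
- apply/subsetP => f thrf.
  rewrite inE (subsetP (triangles_through_subset a_inj aY missA)) //=.
  have /triangles_throughP[f0 fi] := thrf.
  apply/forallP => i; have [->|/fi] := eqVneq i ord0; first by rewrite f0.
  by rewrite !inE setI0 sub0set andbT => /and3P[-> ->].
- by move=> /triangles_throughP[<- _] /triangles_throughP[].
by rewrite card_triangles_through // (miss_only_miss_one missA).
Qed.

Lemma card_ordered_triangles_miss_one :
  (r + t) ^_ r.+1 * M ^ r.+1 <= #|ordered_triangles r t miss_one|.
Proof.
pose inj_into :=
  [set a : {ffun 'I_r.+1 -> T} in ffun_on (mem Y) | injectiveb a].
have <- : #|inj_into| = (r + t) ^_ r.+1.
  by rewrite card_inj_ffuns_on card_ord cardY.
pose miss_only_at (a : {ffun 'I_r.+1 -> T}) :=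
  [set f in ordered_triangles r t miss_one |
     [forall i, f i \in miss_only (a i) set0]].
apply: (card_disjoint_ge (f := miss_only_at)) => [a _|a b f|a].
- by apply/subsetP => f /setIdP[].
- case/setIdP=> _ /forallP fa /setIdP[_ /forallP fb]; apply/ffunP => i.
  exact: miss_only_inj (fa i) (fb i).
case/setIdP=> /ffun_onP aY /injectiveP a_inj.
exact: card_ordered_triangles_miss_only.
Qed.

Hypotheses (t_gt0 : 0 < t) (M_gt0 : 0 < M).

Lemma miss_one_in_triangle A :
  A \in miss_one -> exists2 S, S \in triangles r t miss_one & A \in S.
Proof.
move=> missA; have [l lY lA] := miss_one_miss_only missA.
have lt_r : r < #|Y| by rewrite cardY; lia.
have [a [a_inj aY a0]] := exists_injection_at lY lt_r.
have /card_gt0P[f thrf] : 0 < #|triangles_through a A|.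
  by rewrite card_triangles_through // expn_gt0 M_gt0.
have tri_f : f \in ordered_triangles r t miss_one.
  by apply: (subsetP (triangles_through_subset a_inj aY _)) thrf; rewrite a0.
exists (f @: setT).
  exact: imset_ordered_triangle (rwise_t_intersecting_miss miss_one_sub) tri_f.
by have /triangles_throughP[<- _] := thrf; apply: imset_f.
Qed.

Lemma num_triangles_miss_one_eq F : F \subset miss_at_most_one ->
  num_triangles r t F = num_triangles r t miss_one -> miss_one \subset F.
Proof.
move=> missF eqN; apply/subsetP => A /miss_one_in_triangle[S triS SA].
suff : S \in triangles r t F by rewrite inE => /andP[/subsetP/(_ A SA)].
suff /eqP-> : triangles r t F == triangles r t miss_one by [].
by rewrite eqEcard triangles_miss_one //=; apply/eq_leq/esym.
Qed.

End MissOne.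

Lemma miss_at_most_one_relabel (T : finType) k (s : {perm T})
    (F : {set {set T}}) (Y : {set T}) :
  F \subset miss_at_most_one k Y ->
  relabel s F \subset miss_at_most_one k (s @: Y).
Proof.
have s_inj := @perm_inj _ s.
move=> /subsetP missF; apply/subsetP => _ /imsetP[A /missF + ->].
rewrite !inE !cardsD -imsetI; last by move=> x y _ _; apply: s_inj.
by rewrite !card_imset.
Qed.

(** * Stars and covers *)

(* For [k < j] the truncated subtractions give [1] instead of [0]. *)
Definition star_size n k j := 'C(n - j, k - j).

(* Choose [t] points of a minimum cover of size [c], then extend [c - t] times
   by one of at most [k] points. *)
Definition cover_bound n k t c := 'C(c, t) * (k ^ (c - t) * star_size n k c).

Section Stars.

Variable T : finType.
Implicit Types (A C D U W : {set T}) (F : {set {set T}}).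

Definition uniform k F := {in F, forall A : {set T}, #|A| = k}.

Definition star F U := [set A in F | U \subset A].

Definition t_cover t F W := [forall A in F, t <= #|A :&: W|].

Lemma t_coverP t F W :
  reflect {in F, forall A : {set T}, t <= #|A :&: W|} (t_cover t F W).
Proof. exact: forall_inP. Qed.

Lemma card_star k F U j : uniform k F -> j <= #|U| ->
  #|star F U| <= star_size #|T| k j.
Proof.
move=> unifF leU; have [lt_kj|le_jk] := ltnP k j.
  rewrite (_ : star F U = set0) ?cards0 //; apply/setP => A; rewrite !inE.
  apply/negP => /andP[/unifF card_A /subset_leq_card]; rewrite card_A leqNgt.
  by rewrite (leq_trans lt_kj).
have [U' sub_U' card_U'] := exists_subset_card leU.
rewrite /star_size -cardsT -card_U' -card_between ?subsetT ?card_U' //.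
apply/subset_leq_card/subsetP => A; rewrite !inE => /andP[/unifF-> UA].
by rewrite eqxx subsetT (subset_trans sub_U').
Qed.

Lemma card_star_extend F U D b :
  {in star F U, forall A : {set T}, ~~ [disjoint A & D]} ->
  {in D, forall x, #|star F (x |: U)| <= b} -> #|star F U| <= #|D| * b.
Proof.
move=> hitD; apply: card_covered_le => A starA.
have /pred0Pn[x /= /andP[xA xD]] := hitD A starA; exists x => //.
by move: starA; rewrite !inE => /andP[-> UA]; rewrite subUset sub1set xA.
Qed.

Lemma card_star_cover t F C U b : t_cover t F C -> #|C :&: U| < t ->
  (forall x, x \notin U -> #|star F (x |: U)| <= b) ->
  #|star F U| <= #|C| * b.
Proof.
move=> /t_coverP coverC ltCU star_le.
apply: (@leq_trans (#|C :\: U| * b)); last first.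
  by rewrite leq_mul2r subset_leq_card ?orbT // subsetDl.
apply: card_star_extend => [A /setIdP[FA UA]|x /setDP[_ /star_le //]].
apply: contraL ltCU => disjA; rewrite -leqNgt; apply: leq_trans (coverC A FA) _.
by rewrite subset_leq_card // subsetI subsetIr -setD_eq0 setDE -setIA -setDE
           setI_eq0.
Qed.

Lemma ordered_triangles_small_cover r t F U : t_cover t F U -> #|U| <= t ->
  ordered_triangles r t F = set0.
Proof.
move=> /t_coverP coverU leU; apply/setP => f; rewrite in_set0; apply/negP.
case/ordered_trianglesP=> fF; apply/negP; rewrite -leqNgt.
have sub_U i : U \subset f i.
  by apply/setIidPr/eqP; rewrite eqEcard subsetIr (leq_trans leU) ?coverU.
apply: (@leq_trans #|U|); last exact/subset_leq_card/bigcapsP.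
by rewrite -(setIidPr (sub_U ord0)) coverU.
Qed.

End Stars.

Section Covers.

Variables (T : finType) (k t : nat) (F : {set {set T}}).
Hypothesis unifF : uniform k F.
Hypothesis intF : t_intersecting t F.
Implicit Types A B C D E S U W : {set T}.

Lemma member_t_cover A : A \in F -> t_cover t F A.
Proof.
by move=> FA; apply/t_coverP => B FB; apply: (t_intersectingP t F intF).
Qed.

Lemma card_star_noncover U b : ~~ t_cover t F U ->
  (forall x, x \notin U -> #|star F (x |: U)| <= b) -> #|star F U| <= k * b.
Proof.
rewrite negb_forall_in => /exists_inP[C FC]; rewrite -ltnNge => ltCU.
by rewrite -(unifF FC); apply: card_star_cover ltCU; apply: member_t_cover.
Qed.

Lemma card_star_below_covers c U :
  (forall W, #|W| < c -> ~~ t_cover t F W) -> #|U| <= c ->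
  #|star F U| <= k ^ (c - #|U|) * star_size #|T| k c.
Proof.
move=> noncover leUc; move eq_d : (c - #|U|) => d.
elim: d => [|d IH] in U leUc eq_d *.
  by rewrite mul1n card_star //; lia.
rewrite expnS -mulnA; apply: card_star_noncover => [|x xU].
  by apply: noncover; lia.
by apply: IH; rewrite cardsU1 xU; lia.
Qed.

Lemma card_min_cover W : t_cover t F W ->
  (forall W', #|W'| < #|W| -> ~~ t_cover t F W') -> t <= #|W| ->
  #|F| <= cover_bound #|T| k t #|W|.
Proof.
move=> /t_coverP coverW minW tW; rewrite /cover_bound -cards_draws.
apply: (card_covered_le (f := star F)) => [A FA|E].
  have [E] := exists_subset_card (coverW A FA).
  rewrite subsetI => /andP[EA EW] card_E; exists E.
    by rewrite inE EW card_E /=.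
  by rewrite inE FA.
rewrite inE => /andP[_ /eqP card_E].
by rewrite -[in c in k ^ c]card_E card_star_below_covers ?card_E.
Qed.

Hypothesis ltk : t.+2 <= k.

Let m := star_size #|T| k t.+1.
Let w := star_size #|T| k t.+2.

Definition heavy := [set S : {set T} | (#|S| == t.+1) && (k * w < #|star F S|)].

Lemma card_heavy S : S \in heavy -> #|S| = t.+1.
Proof. by rewrite inE => /andP[/eqP]. Qed.

Lemma card_star_not_heavy S :
  #|S| = t.+1 -> S \notin heavy -> #|star F S| <= k * w.
Proof. by move=> card_S; rewrite inE card_S eqxx -leqNgt. Qed.

Lemma heavy_meets_cover S C : S \in heavy -> t_cover t F C -> #|C| <= k ->
  t <= #|C :&: S|.
Proof.
move=> heavyS coverC leCk; have card_S := card_heavy heavyS.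
move: heavyS; rewrite inE => /andP[_]; apply: contraLR.
rewrite -ltnNge -leqNgt => lt_t.
apply: leq_trans (card_star_cover (b := w) coverC lt_t _) _.
  by move=> x xS; rewrite card_star // cardsU1 xS card_S.
by rewrite leq_mul2r leCk orbT.
Qed.

Lemma heavy_t_cover S : S \in heavy -> t_cover t F S.
Proof.
move=> heavyS; apply/t_coverP => A FA.
by apply: heavy_meets_cover; rewrite ?unifF //; apply: member_t_cover.
Qed.

Lemma heavy_t_intersecting : t_intersecting t heavy.
Proof.
apply/t_intersectingP => S S' heavyS heavyS'.
apply: heavy_meets_cover (heavy_t_cover _) _ => //.
by rewrite (card_heavy heavyS) ltnW.
Qed.

Lemma heavy_triangle_miss_at_most_one : ~~ rwise_t_intersecting 3 t heavy ->
  exists2 Y : {set T}, #|Y| = 2 + t & F \subset miss_at_most_one k Y.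
Proof.
case/rwise3_t_intersectingPn=> S1 [S2 [S3 [heavy1 heavy2 heavy3 lt_t]]].
have heavyI := t_intersectingP t heavy heavy_t_intersecting.
exists (majority S1 S2 S3).
  have := card_majorityE S1 S2 S3; have := card_setI2_le S1 S2 S3.
  have := card_setI2_le S2 S1 S3; have := card_setI2_le S3 S1 S2.
  have := heavyI _ _ heavy1 heavy2; have := heavyI _ _ heavy1 heavy3.
  have := heavyI _ _ heavy2 heavy3.
  rewrite (setIC S2 S1) ![S3 :&: _]setIC (setIAC S1 S3).
  by rewrite (card_heavy heavy1) (card_heavy heavy2) (card_heavy heavy3); lia.
apply/subsetP => A FA; rewrite inE unifF // eqxx majority_setD /=.
have missA S : S \in heavy -> #|S :\: A| <= 1.
  move=> heavyS; have := t_coverP t F S (heavy_t_cover heavyS) A FA.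
  by rewrite cardsD (card_heavy heavyS) setIC; lia.
(* Every point of [Y] lies in two of the three heavy sets. *)
have := card_majority_le (S1 :\: A) (S2 :\: A) (S3 :\: A).
by have := missA _ heavy1; have := missA _ heavy2; have := missA _ heavy3; lia.
Qed.

Lemma heavy_sunflower : rwise_t_intersecting 3 t heavy -> 1 < #|heavy| ->
  exists2 E : {set T}, #|E| = t & {in heavy, forall S : {set T}, E \subset S}.
Proof.
move=> /rwise3_t_intersectingP heavyI3.
case/card_gt1P=> S1 [S2 [heavy1 heavy2 neq12]].
have geE := t_intersectingP t heavy heavy_t_intersecting _ _ heavy1 heavy2.
have card_E : #|S1 :&: S2| = t.
  apply/eqP; rewrite eqn_leq geE andbT leqNgt; apply: contraNN neq12 => ltE.
  have /eqP eqE : S1 :&: S2 == S1.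
    by rewrite eqEcard subsetIl (card_heavy heavy1).
  by rewrite eqEcard -{1}eqE subsetIr !card_heavy /=.
exists (S1 :&: S2) => // S heavyS; apply/setIidPl/eqP.
by rewrite eqEcard subsetIl card_E heavyI3.
Qed.

Definition light := [set A in F | [forall S in heavy, ~~ (S \subset A)]].

Lemma light_subset : light \subset F.
Proof. by apply/subsetP => A /setIdP[]. Qed.

Lemma triangle_light r : rwise_t_intersecting r.+1 t heavy ->
  {in ordered_triangles r t F, forall f : {ffun _}, exists i, f i \in light}.
Proof.
move=> /rwise_t_intersectingP heavyI f /ordered_trianglesP[fF lt_t].
apply/existsP; apply: contraLR lt_t => /existsPn f_heavy; rewrite -leqNgt.
have heavy_sub i : exists S, (S \in heavy) && (S \subset f i).
  have := f_heavy i; rewrite inE fF /= negb_forall => /existsP[S].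
  by rewrite negb_imply negbK; exists S.
pose S i := xchoose (heavy_sub i).
have S_heavy i : S i \in heavy /\ S i \subset f i.
  exact/andP/(xchooseP (heavy_sub i)).
apply: leq_trans (heavyI S _) _ => [i|]; first by case: (S_heavy i).
apply/subset_leq_card/bigcapsP => i _.
apply: subset_trans (bigcap_inf i _) _ => //.
by case: (S_heavy i).
Qed.

Lemma card_star_light S : #|S| = t.+1 -> #|star light S| <= k * w.
Proof.
move=> card_S; have [heavyS|] := boolP (S \in heavy).
  rewrite (_ : star light S = set0) ?cards0 //; apply/setP => A.
  rewrite !inE; apply/negP => /andP[/andP[_ /forall_inP/(_ S heavyS)]].
  by move/negPf=> ->.
move/(card_star_not_heavy card_S); apply: leq_trans; apply: subset_leq_card.
by apply/subsetP => A /setIdP[/(subsetP light_subset) FA SA]; rewrite inE FA.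
Qed.

Lemma card_light_avoiding W i : t_cover t F W -> #|W| = t.+1 -> i \in W ->
  ~~ t_cover t F (W :\ i) ->
  #|star [set A in light | i \notin A] (W :\ i)| <= (k - t) * (k * w).
Proof.
move=> /t_coverP coverW card_W iW; rewrite negb_forall_in => /exists_inP[C FC].
rewrite -ltnNge => ltC.
have card_Wi : #|W :\ i| = t by rewrite card_setD1 // card_W.
apply: (@leq_trans (#|C :\: W| * (k * w))); last first.
  by rewrite leq_mul2r cardsD unifF // leq_sub2l ?orbT ?coverW.
apply: card_star_extend => [A|x /setDP[_ xW]].
  case/setIdP=> /setIdP[lightA iA] _.
  apply: contraL ltC => disjA; rewrite -leqNgt.
  have FA := subsetP light_subset A lightA.
  apply: leq_trans (t_intersectingP t F intF _ _ FA FC) _.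
  apply/subset_leq_card/subsetP => x /setIP[xA xC]; rewrite !inE xC /=.
  apply/andP; split; first by apply: contraNneq iA => <-.
  by apply: contraTT disjA => xW; apply/pred0Pn; exists x; rewrite /= xA inE xW.
apply: leq_trans (card_star_light (S := x |: (W :\ i)) _).
  apply/subset_leq_card/subsetP => A.
  by rewrite !inE -!andbA => /and4P[-> -> _ ->].
by rewrite cardsU1 card_Wi !inE (negPf xW) andbF.
Qed.

Lemma card_light W : t_cover t F W -> #|W| = t.+1 ->
  (forall E, #|E| = t -> ~~ t_cover t F E) ->
  #|light| <= (1 + t.+1 * (k - t)) * (k * w).
Proof.
move=> coverW card_W noncover.
pose avoiding i := star [set A in light | i \notin A] (W :\ i).
have light_covered : light \subset star light W :|: \bigcup_(i in W) avoiding i.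
  apply/subsetP => A lightA; rewrite 2!inE lightA /=.
  have [//|/subsetPn[i iW iA]] := boolP (W \subset A).
  apply/bigcupP; exists i => //.
  apply/setIdP; split; first by rewrite inE lightA.
  have FA := subsetP light_subset A lightA.
  suff /eqP <- : A :&: W == W :\ i by rewrite subsetIl.
  rewrite eqEcard subsetD1 subsetIr !inE (negPf iA) /=.
  have := t_coverP t F W coverW A FA.
  by rewrite card_setD1 // card_W.
apply: leq_trans (subset_leq_card light_covered) _.
apply: leq_trans (leq_card_setU _ _) _.
rewrite mulnDl mul1n leq_add ?card_star_light //.
apply: leq_trans (card_bigcup_le _ _) _; rewrite -mulnA -card_W -sum_nat_const.
apply: leq_sum => i iW; apply: card_light_avoiding => //; apply: noncover.
by rewrite card_setD1 // card_W.
Qed.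

Lemma card_light_heavy : #|F| <= #|light| + #|heavy| * m.
Proof.
have F_covered : F \subset light :|: \bigcup_(S in heavy) star F S.
  apply/subsetP => A FA; rewrite 2!inE FA /=.
  case: (boolP [forall S in heavy, _]) => //; rewrite negb_forall_in /=.
  case/exists_inP=> S heavyS; rewrite negbK => SA.
  by apply/bigcupP; exists S; rewrite // inE FA.
apply: leq_trans (subset_leq_card F_covered) _.
apply: leq_trans (leq_card_setU _ _) _.
rewrite leq_add2l -sum_nat_const; apply: leq_trans (card_bigcup_le _ _) _.
by apply: leq_sum => S heavyS; rewrite card_star // card_heavy.
Qed.

Section Petals.

Variable E : {set T}.
Hypothesis card_core : #|E| = t.
Hypothesis sub_core : {in heavy, forall S : {set T}, E \subset S}.

Definition petals := [set x in ~: E | x |: E \in heavy].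

Lemma card_heavy_petals : #|heavy| <= #|petals|.
Proof.
apply: leq_trans (leq_imset_card (fun x => x |: E) petals).
apply/subset_leq_card/subsetP => S heavyS.
have /cards1P[x SEx] : #|S :\: E| == 1.
  by rewrite cardsDS ?sub_core // (card_heavy heavyS) card_core subSnn.
have eqS : x |: E = S.
  by rewrite -SEx setUC -{1}(setIidPr (sub_core heavyS)) setID.
rewrite -eqS; apply: imset_f; apply/setIdP; rewrite eqS; split=> //.
by have := set11 x; rewrite -SEx => /setDP[_ xE]; rewrite inE.
Qed.

Definition off_core := [set A in F | ~~ (E \subset A)].

Lemma off_core_subset : off_core \subset F.
Proof. by apply/subsetP => A /setIdP[]. Qed.

Lemma off_core_petals A : A \in off_core -> petals \subset A.
Proof.
case/setIdP=> FA nEA; apply/subsetP => x /setIdP[_ heavy_x].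
apply: contraNT nEA => xA; apply/setIidPr/eqP.
rewrite eqEcard subsetIr card_core.
apply: leq_trans (t_coverP t F _ (heavy_t_cover heavy_x) A FA) _.
apply/subset_leq_card/subsetP => y /setIP[yA]; rewrite !inE yA /=.
by case/predU1P=> // eq_yx; rewrite -eq_yx yA in xA.
Qed.

Lemma off_core_miss A : petals != set0 -> A \in off_core ->
  exists2 e, e \in E & E :\ e \subset A.
Proof.
case/set0Pn=> x /setIdP[_ heavy_x] /setIdP[FA /subsetPn[e eE eA]].
exists e => //.
have cap_sub : A :&: E \subset E :\ e.
  by rewrite subsetD1 subsetIr inE (negPf eA).
suff /eqP <- : A :&: E == E :\ e by rewrite subsetIl.
rewrite eqEcard cap_sub card_setD1 // card_core /=.
have := t_coverP t F _ (heavy_t_cover heavy_x) A FA; rewrite setIUr.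
have [+ _] := leq_card_setU (A :&: [set x]) (A :&: E).
have : #|A :&: [set x]| <= 1 by rewrite -(cards1 x) subset_leq_card ?subsetIr.
lia.
Qed.

Lemma card_off_core b : petals != set0 ->
  {in E, forall e, #|star F (petals :|: E :\ e)| <= b} -> #|off_core| <= t * b.
Proof.
move=> petals0; rewrite -card_core; apply: card_covered_le => A offA.
have [e eE subA] := off_core_miss petals0 offA; exists e => //.
by rewrite inE (subsetP off_core_subset) // subUset off_core_petals.
Qed.

Lemma core_gt0 e : e \in E -> 0 < t.
Proof. by rewrite -card_core => eE; apply/card_gt0P; exists e. Qed.

Lemma card_petals_setU e : e \in E -> #|petals :|: E :\ e| = #|petals| + t.-1.
Proof.
move=> eE; rewrite cardsU card_setD1 // card_core.
rewrite (_ : _ :&: _ = set0) ?cards0 ?subn0 //.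
apply/setP => x; rewrite !inE; apply/negP.
by case/andP=> /andP[/negPf-> _]; rewrite andbF.
Qed.

Lemma card_off_core_petals_gt1 : 1 < #|petals| -> #|off_core| <= t * (k * w).
Proof.
move=> gt1; apply: card_off_core => [|e eE]; first by rewrite -card_gt0 ltnW.
have [|U sub_U card_U] := @exists_subset_card T (petals :|: E :\ e) t.+1.
  by have := core_gt0 eE; rewrite card_petals_setU //; lia.
apply: leq_trans (card_star_not_heavy card_U _); last first.
  apply/negP => /sub_core/subset_trans/(_ sub_U)/subsetP/(_ e eE).
  by rewrite !inE eqxx eE.
apply/subset_leq_card/subsetP => A; rewrite !inE => /andP[-> subA].
exact: subset_trans sub_U subA.
Qed.

Lemma card_off_core_petals_gt2 : 2 < #|petals| -> #|off_core| <= t * w.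
Proof.
move=> gt2; apply: card_off_core => [|e eE]; first by rewrite -card_gt0 2?ltnW.
apply: card_star => //; rewrite card_petals_setU //.
by have := core_gt0 eE; lia.
Qed.

Lemma triangle_off_core r :
  {in ordered_triangles r t F, forall f : {ffun _}, exists i, f i \in off_core}.
Proof.
move=> f /ordered_trianglesP[fF lt_t].
apply/existsP; apply: contraLR lt_t => /existsPn on_core.
rewrite -leqNgt -card_core.
apply/subset_leq_card/bigcapsP => i _.
by have := on_core i; rewrite inE fF negbK.
Qed.

End Petals.

End Covers.

(** * Numerical estimates *)

Lemma leq_bin_sub n s j : 'C(n, j.+1) <= 'C(n - s, j.+1) + s * 'C(n.-1, j).
Proof.
elim: s => [|s IH]; first by rewrite subn0 addn0.
apply: leq_trans IH _; rewrite mulSn addnA leq_add2r subnS.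
case eq_ns: (n - s) => [|i] //=; rewrite binS leq_add2l leq_bin2l //; lia.
Qed.

Lemma mul_star_size n k j : j < k ->
  (n - j) * star_size n k j.+1 = (k - j) * star_size n k j.
Proof.
by move=> ltjk; rewrite /star_size subnS mul_bin_diag -subSn.
Qed.

Section Estimates.

Variables n k t : nat.
Hypotheses (k_ge3 : 3 <= k) (n_ge : k ^ 4 <= n).

Lemma leq_cube_add : k ^ 3 + k <= n.
Proof. by apply: leq_trans n_ge; rewrite !expnS expn0; nia. Qed.

Lemma leq_cover_boundS c :
  t <= c < k -> cover_bound n k t c.+1 <= cover_bound n k t c.
Proof.
case/andP=> letc ltck; have n_large := leq_cube_add.
have factor_gt0 : 0 < (c.+1 - t) * (n - c).
  by rewrite muln_gt0 subn_gt0 ltnS letc /=; lia.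
rewrite -(leq_pmul2l factor_gt0) /cover_bound subSn // expnS.
set s' := star_size n k c.+1.
have -> : (c - t).+1 * (n - c) * ('C(c.+1, t) * (k * k ^ (c - t) * s')) =
    ((c - t).+1 * 'C(c.+1, t)) * (k * k ^ (c - t)) * ((n - c) * s').
  by rewrite -!mulnA; lia.
rewrite /s' mul_star_size // -subSn // -mul_bin_down /=.
have -> : c.+1 * 'C(c, t) * (k * k ^ (c - t)) * ((k - c) * star_size n k c) =
    c.+1 * (k * (k - c)) * ('C(c, t) * (k ^ (c - t) * star_size n k c)) by lia.
rewrite leq_mul2r; apply/orP; right; apply: (@leq_trans (k ^ 3)).
  by rewrite !expnS expn0 muln1 leq_mul // leq_mul2l leq_subr orbT.
by apply: (@leq_trans (n - c)); [lia | rewrite leq_pmull // subn_gt0].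
Qed.

Lemma cover_bound_anti c d : t <= c -> c <= d <= k ->
  cover_bound n k t d <= cover_bound n k t c.
Proof.
move=> letc; elim: d => [|d IH]; first by rewrite leqn0 => /andP[/eqP->].
rewrite leq_eqVlt andb_orl => /orP[/andP[/eqP-> //]|/andP[lecd ltdk]].
apply: leq_trans (leq_cover_boundS _) (IH _); first by rewrite (leq_trans letc).
by rewrite -ltnS lecd ltnW.
Qed.

Hypotheses (t_gt0 : 0 < t) (ltk : t.+2 <= k).

Let m := star_size n k t.+1.
Let w := star_size n k t.+2.

Lemma star_size_gt0 : 0 < m.
Proof.
by rewrite bin_gt0 leq_sub2r // (leq_trans _ leq_cube_add) ?leq_addl.
Qed.

Lemma star_size_ratio : k ^ 2 * (k + 2) * w <= m.
Proof.
have n_large := leq_cube_add; have factor_gt0 : 0 < k - t.+1 by lia.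
rewrite -(leq_pmul2l factor_gt0) -mul_star_size // mulnA leq_mul2r.
apply/orP; right.
apply: (@leq_trans ((k - 2) * (k ^ 2 * (k + 2)))).
  by rewrite leq_mul2r; apply/orP; right; lia.
have [j eq_k] : exists j, k = j + 2 by exists (k - 2); lia.
have eq_k4 : k ^ 4 = (k - 2) * (k ^ 2 * (k + 2)) + 4 * k ^ 2.
  by rewrite eq_k addnK !expnS !expn0; lia.
have k_sq : k <= k ^ 2 by rewrite -{1}(expn1 k) leq_pexp2l //; lia.
by move: n_ge; rewrite eq_k4; lia.
Qed.

Lemma cover_bound_le_star_size : 2 * cover_bound n k t t.+2 <= t.+1 * m.
Proof.
have bin_t : 2 * 'C(t.+2, t) = t.+1 * t.+2.
  have <- : 'C(t.+2, 2) = 'C(t.+2, t).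
    by rewrite -(@bin_sub t.+2 2) // !subSS subn0.
  by rewrite -mul_bin_diag bin1 mulnC.
rewrite /cover_bound mulnA bin_t -mulnA leq_mul2l /=.
rewrite (_ : t.+2 - t = 2); last by lia.
apply: leq_trans star_size_ratio; rewrite mulnA leq_mul2r mulnC leq_mul2l -/w.
by rewrite addn2 (leq_trans ltk) ?orbT // leqW.
Qed.

Lemma star_size_le_avoiding : 4 * m <= 5 * 'C(n - k.+1, k - t.+1).
Proof.
have n_large := leq_cube_add; have := leq_bin_sub (n - t.+1) (k - t) (k - t.+2).
rewrite -subnS -subSn // subSS (_ : n - t.+1 - (k - t) = n - k.+1); last by lia.
rewrite -/(star_size n k t.+1) -/(star_size n k t.+2) -/m -/w => m_le.
have : 5 * k * w <= m.
  apply: leq_trans star_size_ratio; rewrite leq_mul2r -/w; apply/orP; right.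
  by rewrite expnS expn1; nia.
have : (k - t) * w <= k * w by rewrite leq_mul2r leq_subr orbT.
by lia.
Qed.

End Estimates.

(** * The extremal problem *)

Section UpperBound.

Variables (T : finType) (k t : nat) (F : {set {set T}}).
Hypotheses (k_ge3 : 3 <= k) (t_gt0 : 0 < t) (ltk : t.+2 <= k).
Hypothesis T_large : k ^ 4 <= #|T|.
Hypotheses (unifF : uniform k F) (intF : t_intersecting t F).
Implicit Types (E W : {set T}) (L : {set {set T}}).

Let m := star_size #|T| k t.+1.
Let w := star_size #|T| k t.+2.

Let threshold := t.+2 ^_ 3 * m ^ 3.

Let m_gt0 : 0 < m.
Proof. exact: star_size_gt0. Qed.

Lemma triangle_thresholdE : threshold = t * t.+1 * t.+2 * m ^ 3.
Proof. by rewrite /threshold !ffactnS ffactn0 /=; lia. Qed.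

Lemma triangle_threshold_gt0 : 0 < threshold.
Proof. by rewrite muln_gt0 ffact_gt0 !ltnS t_gt0 expn_gt0 m_gt0. Qed.

Lemma card_no_small_cover :
  (forall W, #|W| <= t.+1 -> ~~ t_cover t F W) -> 2 * #|F| <= t.+1 * m.
Proof.
move=> noncover; have [A FA _] : exists2 A, A \in F & #|A :&: set0| < t.
  have := noncover set0; rewrite cards0 => /(_ isT).
  by rewrite negb_forall_in => /exists_inP[A FA]; rewrite -ltnNge; exists A.
case: (arg_minnP (fun W => #|W|) (member_t_cover intF FA)) => W coverW minW.
have ltW : t.+1 < #|W|.
  by rewrite ltnNge; apply: contraTN coverW; apply: noncover.
have leW : #|W| <= k by rewrite -(unifF FA) minW ?member_t_cover.
apply: leq_trans (cover_bound_le_star_size k_ge3 T_large t_gt0 ltk).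
rewrite leq_mul2l /=; apply: leq_trans (card_min_cover unifF intF coverW _ _) _.
- by move=> W'; rewrite ltnNge; apply: contraNN; apply: minW.
- by do 2!apply: ltnW.
by apply: cover_bound_anti => //; rewrite ?ltW ?leW //; lia.
Qed.

Lemma ordered_triangles_few_members :
  2 * #|F| <= t.+1 * m -> 2 * #|ordered_triangles 2 t F| < threshold.
Proof.
rewrite -(@leq_exp2r _ _ 3) // !expnMn => cube.
have leF := card_ordered_triangles_le 2 t F.
have : 0 < m ^ 3 by rewrite expn_gt0 m_gt0.
rewrite triangle_thresholdE; set o := #|ordered_triangles _ _ _| in leF *.
move: (m ^ 3) (#|F| ^ 3) o cube leF => M f o cube leF M0.
have : 16 * o <= 2 * t.+1 ^ 3 * M by lia.
have : 2 * t.+1 ^ 3 < 8 * (t * t.+1 * t.+2) by rewrite !expnS expn0; nia.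
by nia.
Qed.

Lemma card_light_third W : t_cover t F W -> #|W| = t.+1 ->
  (forall E, #|E| = t -> ~~ t_cover t F E) -> 3 * #|light k t F| <= m.
Proof.
move=> coverW card_W noncover.
have light_le := card_light unifF intF coverW card_W noncover.
apply: leq_trans (leq_mul (leqnn 3) light_le) _.
apply: leq_trans (star_size_ratio k_ge3 T_large t_gt0 ltk).
rewrite mulnA -/w (_ : k ^ 2 * _ * w = k * (k + 2) * (k * w)); last first.
  by rewrite expnS expn1; lia.
rewrite leq_mul2r; apply/orP; right.
have [a eq_t] : exists a, t = a.+1 by exists t.-1; lia.
have [b eq_k] : exists b, k = t + b.+2 by exists (k - t.+2); lia.
have : a * b <= a * a + b * b by clear; nia.
by rewrite eq_k addKn eq_t; clear; lia.
Qed.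

Lemma card_le_few_heavy b :
  3 * #|light k t F| <= m -> #|heavy k t F| <= b -> 3 * #|F| <= (3 * b + 1) * m.
Proof.
move=> light_le heavy_le; have := card_light_heavy t unifF; rewrite -/m.
have : #|heavy k t F| * m <= b * m by rewrite leq_mul2r heavy_le orbT.
by lia.
Qed.

Lemma ordered_triangles_hit_lt L b :
  {in ordered_triangles 2 t F, forall f : {ffun _}, exists i, f i \in L} ->
  3 * #|F| <= (3 * b + 1) * m -> (3 * b + 1) ^ 2 * #|L| <= 8 * (t * m) ->
  2 * #|ordered_triangles 2 t F| < threshold.
Proof.
move=> hitL F_le L_le; have ord_le := card_ordered_triangles_hit hitL.
have ord_le_L :
    3 * #|ordered_triangles 2 t F| <= (3 * b + 1) ^ 2 * #|L| * m ^ 2.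
  apply: (@leq_trans (#|L| * (3 * #|F|) ^ 2)).
    by rewrite expnMn; move: ord_le; clear; lia.
  by rewrite -mulnA (mulnCA _ #|L|) -expnMn leq_mul2l leq_exp2r // F_le orbT.
have ord_le_m : 3 * #|ordered_triangles 2 t F| <= 8 * (t * m ^ 3).
  apply: leq_trans ord_le_L _.
  by rewrite (expnS m 2) (mulnA t) (mulnA 8) leq_mul2r L_le orbT.
have tm_gt0 : 0 < t * m ^ 3 by rewrite muln_gt0 t_gt0 expn_gt0 m_gt0.
have : 6 * t * m ^ 3 <= threshold.
  by rewrite triangle_thresholdE leq_mul2r; apply/orP; right; clear -t_gt0; nia.
by move: threshold ord_le_m tm_gt0 => M; clear; lia.
Qed.

Section HeavySunflower.

Hypothesis heavyI : rwise_t_intersecting 3 t (heavy k t F).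
Hypothesis light_le : 3 * #|light k t F| <= m.

Lemma ordered_triangles_heavy_le1 :
  #|heavy k t F| <= 1 -> 2 * #|ordered_triangles 2 t F| < threshold.
Proof.
move=> /(card_le_few_heavy light_le) F_le.
apply: ordered_triangles_hit_lt (triangle_light heavyI) F_le _.
by move: light_le t_gt0; clear; move: m #|light _ _ _| => a b; nia.
Qed.

Variable E : {set T}.
Hypothesis card_core : #|E| = t.
Hypothesis sub_core : {in heavy k t F, forall S : {set T}, E \subset S}.

Lemma ordered_triangles_heavy_eq2 :
  #|heavy k t F| = 2 -> 2 * #|ordered_triangles 2 t F| < threshold.
Proof.
move=> heavy_eq2; have F_le := card_le_few_heavy light_le (eq_leq heavy_eq2).
apply: ordered_triangles_hit_lt (triangle_off_core card_core (r := 2)) F_le _.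
have := card_off_core_petals_gt1 unifF intF ltk card_core sub_core.
rewrite -/w => /(_ (leq_trans _ (card_heavy_petals card_core sub_core))).
rewrite heavy_eq2 => /(_ isT) off_le.
apply: leq_trans (leq_mul (leqnn _) off_le) _.
apply: (@leq_trans (8 * (t * (k ^ 2 * (k + 2) * w)))); last first.
  by rewrite !leq_mul2l star_size_ratio ?orbT.
rewrite (_ : 8 * _ = 8 * (k * (k + 2)) * (t * (k * w))); last first.
  by rewrite expnS expn1; move: w; clear; lia.
by rewrite leq_mul2r; apply/orP; right; clear -k_ge3; nia.
Qed.

Lemma ordered_triangles_heavy_gt2 :
  2 < #|heavy k t F| -> 2 * #|ordered_triangles 2 t F| < threshold.
Proof.
move=> heavy_gt2.
have [->|/set0Pn[f tri_f]] := eqVneq (ordered_triangles 2 t F) set0.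
  by rewrite cards0 triangle_threshold_gt0.
have petals_ge := card_heavy_petals card_core sub_core.
have heavy_le : #|heavy k t F| <= k.
  have [i offi] := triangle_off_core card_core tri_f.
  apply: leq_trans petals_ge _.
  rewrite -[leqRHS](unifF (subsetP (off_core_subset F E) _ offi)).
  exact: subset_leq_card (off_core_petals unifF intF card_core offi).
have F_le := card_le_few_heavy light_le heavy_le.
apply: ordered_triangles_hit_lt (triangle_off_core card_core (r := 2)) F_le _.
have petals_gt2 := leq_trans heavy_gt2 petals_ge.
have off_le := card_off_core_petals_gt2 unifF intF ltk card_core petals_gt2.
apply: (@leq_trans (8 * (k ^ 2 * (k + 2)) * (t * w))).
  by apply: leq_mul off_le; rewrite !expnS !expn0; clear -k_ge3; nia.
by rewrite -mulnA leq_mul2l mulnCA leq_mul2l star_size_ratio ?orbT.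
Qed.

End HeavySunflower.

Lemma ordered_triangles_lt : rwise_t_intersecting 3 t (heavy k t F) ->
  2 * #|ordered_triangles 2 t F| < threshold.
Proof.
move=> heavyI; have [/existsP[U /andP[coverU leU]]|/existsPn noncover_t] :=
    boolP [exists U : {set T}, t_cover t F U && (#|U| <= t)].
  rewrite (ordered_triangles_small_cover 2 coverU leU) cards0.
  exact: triangle_threshold_gt0.
have noncover (U : {set T}) : #|U| <= t -> ~~ t_cover t F U.
  by move=> leU; have := noncover_t U; rewrite leU andbT.
have [/existsP[W /andP[/eqP card_W coverW]]|/existsPn noncover_t1] :=
    boolP [exists W : {set T}, (#|W| == t.+1) && t_cover t F W]; last first.
  apply/ordered_triangles_few_members/card_no_small_cover => W.
  rewrite leq_eqVlt => /orP[card_W|]; last exact: noncover.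
  by have := noncover_t1 W; rewrite card_W.
have light_le : 3 * #|light k t F| <= m.
  apply: card_light_third coverW card_W _ => U card_U.
  by rewrite noncover ?card_U.
have [heavy_le1|heavy_gt1] := leqP #|heavy k t F| 1.
  exact: ordered_triangles_heavy_le1.
have [E card_core sub_core] := heavy_sunflower unifF intF ltk heavyI heavy_gt1.
have [heavy_gt2|heavy_le2] := ltnP 2 #|heavy k t F|.
  exact: ordered_triangles_heavy_gt2 sub_core _.
apply: ordered_triangles_heavy_eq2 sub_core _ => //.
by apply/eqP; rewrite eqn_leq heavy_le2.
Qed.

Lemma avoiding_gt0 : 0 < 'C(#|T| - k.+1, k - t.+1).
Proof.
by have := star_size_le_avoiding k_ge3 T_large t_gt0 ltk; rewrite -/m; lia.
Qed.

Section Comparison.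

Variable Y : {set T}.
Hypothesis cardY : #|Y| = 2 + t.

Lemma triangle_threshold_le :
  threshold <= 2 * #|ordered_triangles 2 t (miss_one k Y)|.
Proof.
pose M := 'C(#|T| - k.+1, k - t.+1).
have ordered_ge : t.+2 ^_ 3 * M ^ 3 <= #|ordered_triangles 2 t (miss_one k Y)|.
  by apply: card_ordered_triangles_miss_one cardY _ _; rewrite // leqW.
have m_le : m ^ 3 <= 2 * M ^ 3.
  have : 4 ^ 3 * m ^ 3 <= 5 ^ 3 * M ^ 3.
    by rewrite -!expnMn leq_exp2r // star_size_le_avoiding.
  by move: (m ^ 3) (M ^ 3) => a b; clear; lia.
apply: leq_trans (leq_mul (leqnn 2) ordered_ge).
by rewrite mulnCA leq_mul2l m_le orbT.
Qed.

Lemma num_triangles_concentrated_or_lt :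
  (exists s : {perm T}, relabel s F \subset miss_at_most_one k Y) \/
  num_triangles 2 t F < num_triangles 2 t (miss_one k Y).
Proof.
have [heavyI|tri_heavy] := boolP (rwise_t_intersecting 3 t (heavy k t F)).
  right; have := leq_trans (ordered_triangles_lt heavyI) triangle_threshold_le.
  rewrite !card_ordered_triangles ?ltn_pmul2l //.
    exact: (rwise_t_intersecting_miss cardY (miss_one_sub k Y)).
  exact: rwise2_t_intersecting.
left; have [Z cardZ missF] :=
  heavy_triangle_miss_at_most_one unifF intF ltk tri_heavy.
have [s sZ] := exists_perm_imset (etrans cardZ (esym cardY)).
by exists s; rewrite -sZ; apply: miss_at_most_one_relabel.
Qed.

Lemma num_triangles_le_miss_one :
  num_triangles 2 t F <= num_triangles 2 t (miss_one k Y).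
Proof.
case: num_triangles_concentrated_or_lt => [[s missF]|]; last exact: ltnW.
rewrite -(num_triangles_relabel 2 t s).
exact: num_triangles_miss_one_le cardY _ missF.
Qed.

Lemma num_triangles_eq_miss_one :
  num_triangles 2 t F = num_triangles 2 t (miss_one k Y) ->
  exists2 s : {perm T}, miss_one k Y \subset relabel s F &
    relabel s F \subset miss_at_most_one k Y.
Proof.
move=> eqN; case: num_triangles_concentrated_or_lt => [[s missF]|]; last first.
  by rewrite eqN ltnn.
exists s => //; apply: num_triangles_miss_one_eq cardY _ _ _ _ _ missF _ => //.
- exact: leqW.
- exact: avoiding_gt0.
by rewrite num_triangles_relabel.
Qed.

End Comparison.

End UpperBound.

Lemma card_init_seg n j : j <= n -> #|init_seg n j| = j.
Proof.
move=> lejn; have widen_inj : injective (widen_ord lejn).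
  by move=> x y /(congr1 val) /= /val_inj.
rewrite -[RHS]card_ord -(card_imset _ widen_inj); apply: eq_card => i.
rewrite inE; apply/idP/imsetP => [ltij|[x _ ->]] //=.
by exists (Ordinal ltij) => //; apply: val_inj.
Qed.

Lemma G_famE n k r t :
  0 < r + t <= n -> G_fam n k r t = miss_one k (init_seg n (r + t)).
Proof.
case/andP=> rt_gt0 le_n; apply/setP => A; rewrite !inE; congr (_ && _).
by have := cardsID A (init_seg n (r + t)); rewrite card_init_seg // setIC; lia.
Qed.

Lemma G'_famE n k r t :
  r + t <= n -> G'_fam n k r t = miss_at_most_one k (init_seg n (r + t)).
Proof.
move=> le_n; apply/setP => A; rewrite !inE; congr (_ && _).
by have := cardsID A (init_seg n (r + t)); rewrite card_init_seg // setIC; lia.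
Qed.

Theorem theorem1p3 (n k t : nat) (F : {set {set 'I_n}})
  (hk : 3 <= k) (ht1 : 1 <= t) (htk : t <= k - 2) (hn : k ^ 4 <= n)
  (hF : F \subset ksubsets n k) (hint : t_intersecting t F) :
  num_triangles 2 t F <= num_triangles 2 t (G_fam n k 2 t) /\
  (num_triangles 2 t F = num_triangles 2 t (G_fam n k 2 t) <->
   exists F' : {set {set 'I_n}},
     [/\ isomorphic F F', G_fam n k 2 t \subset F' & F' \subset G'_fam n k 2 t]).
Proof.
have ltk : t.+2 <= k by lia.
have le_n : 2 + t <= n by have := leq_cube_add hk hn; lia.
have unifF : uniform k F by move=> A /(subsetP hF); rewrite inE => /eqP.
have T_large : k ^ 4 <= #|'I_n| by rewrite card_ord.
have cardY := card_init_seg le_n; rewrite G_famE // G'_famE //.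
split; first exact: num_triangles_le_miss_one.
split=> [eqN|[F' [[s ->] oneF' missF']]]; last first.
  rewrite -(num_triangles_relabel 2 t s).
  exact: num_triangles_miss_one cardY _ oneF' missF'.
have [s oneF missF] :=
  num_triangles_eq_miss_one hk ht1 ltk T_large unifF hint cardY eqN.
by exists (relabel s F); split=> //; exists s.
Qed.
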